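(* For ANF-Tree (all-or-nothing flow in trees), the integrality gap of $P^t$ is $O(k/t)$, where $k$ is the number of requests of the instance and $P^t$ is the $t$-th level of the knapsack intersection hierarchy applied to the natural LP relaxation; and there are ANF-Tree instances where the integrality gap of $P^t$ is $\Omega(k/t)$.
   Context: An instance of ANF-Tree consists of an undirected tree $(V,E)$ with edge capacities $u_e>0$, and a finite set $R$ of requests; each $r\in R$ has distinct endpoints $s_r\ne t_r$ in $V$, a demand $d_r\ge0$ and a profit $w_r\ge0$. Let $P_r$ be the unique simple path between $s_r$ and $t_r$, and $R_e=\{r\in R:e\in P_r\}$. Write $k=|R|$ and $m=|E|$. The natural LP polytope is $P=\{x\in[0,1]^R:\sum_{r\in R_e}d_rx_r\le u_e\ \forall e\in E\}$ and $P_I=\operatorname{conv}(P\cap\{0,1\}^R)$. For $S\subseteq E$ let $K(S)=\{x\in[0,1]^R:\sum_{r\in R_e}d_rx_r\le u_e\ \forall e\in S\}$ and $K_I(S)=\operatorname{conv}(K(S)\cap\{0,1\}^R)$. For $t\in\{1,\dots,m\}$ the $t$-th level of the knapsack intersection hierarchy is $P^t=\bigcap_{S\subseteq E,\,|S|=t}K_I(S)$. The integrality gap of $P^t$ on an instance is $\max\{w^Tx:x\in P^t\}/\max\{w^Tx:x\in P_I\}$.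
   Formalization: The upper bound O(k/t) is stated as O(max(1, k/t)), since the gap is always at least 1 and t may exceed k (as t ranges up to the number of edges), where the literal bound fails; for t ≤ k it is exactly O(k/t). *)

(* Defs.v *)
From HB Require Import structures.
From mathcomp Require Import all_boot all_order all_algebra.
From mathcomp Require Import all_classical all_reals.
From mathcomp Require Import convex.

Set Implicit Arguments.
Unset Strict Implicit.
Unset Printing Implicit Defensive.
Import Order.TTheory GRing.Theory Num.Theory.

Local Open Scope classical_set_scope.
Local Open Scope ring_scope.

                                                                    
Definition adj (V : finType) (E : {set {set V}}) : rel V :=
  fun x y => [set x; y]%SET \in E.

Definition simple_graph (V : finType) (E : {set {set V}}) : Prop :=
  forall e, e \in E -> #|e| = 2%N.

                                                                            
                                  
Record is_tree (V : finType) (E : {set {set V}}) : Prop := IsTree {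
  tree_nonempty : (0 < #|V|)%N;
  tree_simple : simple_graph E;
  tree_connected : forall x y : V, connect (adj E) x y;
  tree_acyclic : forall c : seq V, (2 < size c)%N -> ~ ucycle (adj E) c
}.

Record anf_tree (R : realType) := AnfTree {
  vtx : finType;
  edges : {set {set vtx}};
  treeP : is_tree edges;
  cap : {set vtx} -> R;
  cap_gt0 : forall e, e \in edges -> 0 < cap e;
  req : finType;
  src : req -> vtx;
  dst : req -> vtx;
  src_neq_dst : forall r, src r != dst r;
  dem : req -> R;
  dem_ge0 : forall r, 0 <= dem r;
  profit : req -> R;
  profit_ge0 : forall r, 0 <= profit r
}.

Section Paths.
Variables (V : finType) (E : {set {set V}}).

                                                                            
                           
Definition simple_path (x y : V) (p : seq V) : bool :=
  [&& path (adj E) x p, uniq (x :: p) & last x p == y].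

Definition walk_edges (x : V) (p : seq V) : seq {set V} :=
  pairmap (fun u v => [set u; v]%SET) x p.

Lemma simple_path_ex (T : is_tree E) (x y : V) : exists p, simple_path x y p.
Proof.
have /connectP[p pP ->] := tree_connected T x y.
have [q qP uq _] := shortenP pP.
by exists q; rewrite /simple_path qP uq eqxx.
Qed.

                                                               
Definition tree_path (T : is_tree E) (x y : V) : seq V :=
  xchoose (simple_path_ex T x y).

End Paths.

Section Polytopes.
Variables (R : realType) (I : anf_tree R).

                                                                         
                                            
Definition reqvec := {ffun req I -> R^o}.

Definition nreq : nat := #|{: req I}|.
Definition nedge : nat := #|edges I|.

Definition req_path (r : req I) : seq {set vtx I} :=
  walk_edges (src r) (tree_path (treeP I) (src r) (dst r)).

Definition req_on (e : {set vtx I}) : {set req I} :=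
  [set r : req I | e \in req_path r]%SET.

Definition K_lp (S : {set {set vtx I}}) : set reqvec :=
  [set x | (forall r, 0 <= x r <= 1) /\
    (forall e, e \in S -> \sum_(r in req_on e) dem r * x r <= cap e)].

Definition P_lp : set reqvec := K_lp (edges I).

Definition binary : set reqvec := [set x | forall r, x r = 0 \/ x r = 1].

Definition conv_hull (M : lmodType R) (A : set M) : set M :=
  smallest (fun B : set M => convex_set (B : set (convex_lmodType M))) A.

Definition P_hull : set reqvec := conv_hull (P_lp `&` binary).
Definition K_hull (S : {set {set vtx I}}) : set reqvec :=
  conv_hull (K_lp S `&` binary).

Definition P_level (t : nat) : set reqvec :=
  \bigcap_(S in [set S : {set {set vtx I}} | S \subset edges I /\ #|S| = t])
    K_hull S.

Definition total_profit (x : reqvec) : R := \sum_r profit r * x r.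

                                                                        
                                  
Definition max_profit (A : set reqvec) : R := sup (total_profit @` A).

                                                                   
Definition integrality_gap (t : nat) : \bar R :=
  ((max_profit (P_level t))%:E / (max_profit P_hull)%:E)%E.

End Polytopes.

(* Main.v *)
(** Upper bound: rooting the tree, the vertex sets below two edges are nested or
    disjoint, so their nonempty traces on the at most [2 q] endpoints of [q]
    requests number at most [4 q].  Restricted to those requests, a capacity
    constraint depends only on the trace of its edge; hence for [4 q <= t], [t] edges
    carry all of them, and a point of [P^t] earns at most the optimum on any [q]
    requests.  Cut the requests into [O(k / q)] such groups; for [t < 4] use
    singletons.
    Lower bound: on a path, request [r] goes from vertex [0] to [r + 1] with demand
    and last-edge capacity [2^-r].  Two requests always conflict, so the optimum is
    [1].  For [t] edges, the requests ending at none of them are jointly feasible,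
    and so is each single request; averaging these [t + 1] points gives the
    constant vector [1 / (t + 1)], of profit [k / (t + 1)]. *)
Require Import Defs.
From mathcomp Require Import all_boot all_order all_algebra.
From mathcomp Require Import all_classical all_reals.
From mathcomp Require Import interval_inference convex zify lra.

Set Implicit Arguments.
Unset Strict Implicit.
Unset Printing Implicit Defensive.
Import Order.TTheory GRing.Theory Num.Theory.
Local Open Scope ring_scope.

(** * Size of laminar families *)

Definition laminar (T : finType) (F : {set {set T}}) : Prop :=
  forall A B, A \in F -> B \in F ->
    [|| A \subset B, B \subset A | [disjoint A & B]].

(** Induction on [#|Z|], deleting a point [z] from every member of [F]. Only the singleton of [z]
    vanishes, and two members merge only if they are [A] and [A :\ z], which laminarity allows for
    at most one [A]. So each point costs at most two sets. *)
Lemma laminar_card (T : finType) (F : {set {set T}}) (Z : {set T}) :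
  laminar F -> finset.set0 \notin F -> (forall A, A \in F -> A \subset Z) ->
  (#|F| <= 2 * #|Z|)%N.
Proof.
have [n] := ubnP #|Z|; elim: n => // n IHn in F Z *.
move=> Zn lamF F0 FZ; case: (finset.set_0Vmem Z) => [Z0|[z zZ]].
  rewrite Z0 cards0 muln0 leqn0 cards_eq0.
  apply/eqP/finset.setP => A; rewrite inE; apply/negP => AF.
  move: (FZ _ AF); rewrite Z0 finset.subset0 => /eqP A0.
  by move: F0; rewrite -A0 AF.
pose G := ((fun A => A :\ z)%SET @: F :\ finset.set0)%SET.
have lamG : laminar G.
  move=> _ _ /finset.setD1P[_ /imsetP[A AF ->]] /finset.setD1P[_ /imsetP[B BF ->]].
  case/or3P: (lamF _ _ AF BF) => [AB|BA|dAB].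
  - by rewrite finset.setSD.
  - by rewrite [X in [|| _, X | _]]finset.setSD ?orbT.
  - by rewrite (disjointWl _ (disjointWr _ dAB)) ?subsetDl ?orbT.
have GZ A : A \in G -> A \subset (Z :\ z)%SET.
  by case/finset.setD1P => _ /imsetP[B /FZ BZ ->]; rewrite finset.setSD.
have Zz : #|Z| = (#|(Z :\ z)%SET|).+1 by rewrite (cardsD1 z Z) zZ.
have G0 : finset.set0 \notin G by rewrite !inE eqxx.
have cG : (#|G| <= 2 * #|(Z :\ z)%SET|)%N.
  by apply: IHn => //; rewrite Zz ltnS in Zn.
pose B := [set A in F | [&& z \in A, (A :\ z)%SET \in F & A != [set z]%SET]]%SET.
have cB : (#|B| <= 1)%N.
  apply/card_le1_eqP.
  (* Members of [B] share [z], hence are nested; comparing the smaller one with [Y :\ z] instead of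
     [Y] forces equality. *)
  have key X Y : X \in B -> Y \in B -> X \subset Y -> X = Y.
    rewrite !inE => /and4P[XF zX _ Xz] /and4P[YF zY Yz _] XY.
    apply/eqP; rewrite finset.eqEsubset XY /=.
    case/or3P: (lamF _ _ XF Yz) => [XYz|YX|dXY].
    - by have := fintype.subsetP XYz z zX; rewrite !inE eqxx.
    - apply/fintype.subsetP => y yY; have [-> //|yz] := eqVneq y z.
      by apply: (fintype.subsetP YX); rewrite !inE yz.
    - have [x xX xz] : exists2 x, x \in X & x != z.
        apply/exists_inP; apply: contraNT Xz => /exists_inPn xz.
        rewrite finset.eqEsubset finset.sub1set zX andbT; apply/fintype.subsetP => x xX.
        by rewrite inE -[_ == _]negbK xz.
      by move/pred0P: dXY => /(_ x) /=; rewrite !inE xX xz (fintype.subsetP XY).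
  move=> X Y XB YB; have XF := XB; have YF := YB.
  move: XF YF; rewrite !inE => /and4P[XF zX _ _] /and4P[YF zY _ _].
  case/or3P: (lamF _ _ XF YF) => [XY|YX|dXY].
  - by apply/esym; exact: key.
  - exact: key.
  - by move/pred0P: dXY => /(_ z) /=; rewrite zX zY.
pose H := (F :\ [set z]%SET :\: B)%SET.
have cH : (#|H| <= #|G|)%N.
  have injH : {in H &, injective (fun A => A :\ z)%SET}.
    move=> X Y; rewrite !inE => /andP[XB /andP[Xz XF]] /andP[YB /andP[Yz YF]] eXY.
    rewrite XF Xz andbT /= in XB; rewrite YF Yz andbT /= in YB.
    have nzE (W : {set T}) : z \notin W -> (W :\ z)%SET = W.
      by move=> zW; apply/finset.setDidPl; rewrite disjoint_sym disjoints1.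
    have [zX|zX] := boolP (z \in X); have [zY|zY] := boolP (z \in Y).
    - by rewrite -(finset.setD1K zX) -(finset.setD1K zY) eXY.
    - by move: XB; rewrite zX eXY nzE // YF.
    - by move: YB; rewrite zY -eXY nzE // XF.
    - by rewrite -(nzE X) // -(nzE Y).
  rewrite -(card_in_imset injH); apply/subset_leq_card/fintype.subsetP.
  move=> _ /imsetP[X XH ->]; move: XH; rewrite !inE => /andP[_ /andP[Xz XF]].
  apply/andP; split; last by apply/imsetP; exists X.
  apply: contra Xz.
  rewrite finset.setD_eq0 finset.subset1 => /orP[//|/eqP X0].
  by move: F0; rewrite -X0 XF.
have cF : (#|F| <= #|H| + 2)%N.
  have -> : (#|H| + 2 = 1 + (#|H| + 1))%N by rewrite add1n addn1 addn2.
  rewrite (cardsD1 [set z]%SET F); apply: leq_add; first by case: (_ \in _).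
  rewrite -(cardsID B (F :\ [set z]%SET)%SET) addnC leq_add2l.
  apply: leq_trans cB; apply: subset_leq_card; exact: finset.subsetIr.
by rewrite Zz mulnS addnC (leq_trans cF) // leq_add2r (leq_trans cH).
Qed.

(** * Edge removal and rooted sides in a tree *)

Section Bridges.
Variables (V : finType) (E : {set {set V}}).
Hypothesis T : is_tree E.

Lemma adj_sym (F : {set {set V}}) : symmetric (adj F).
Proof. by move=> x y; rewrite /adj finset.setUC. Qed.

Lemma connect_adj_sym (F : {set {set V}}) : connect_sym (adj F).
Proof. exact/sym_connect_sym/adj_sym. Qed.

Lemma edge_ends e : e \in E -> exists a b, [/\ a != b & e = [set a; b]%SET].
Proof.
by move=> /(tree_simple T)/eqP/cards2P[a [b [ab ->]]]; exists a, b.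
Qed.

(** A path from [a] to [b] avoiding the edge would close up with it to a cycle. *)
Lemma bridge a b : [set a; b]%SET \in E -> a != b ->
  ~~ connect (adj (E :\ [set a; b]%SET)%SET) a b.
Proof.
move=> abE ab; apply/negP => /connectP[p pP lp]; move: pP ab lp.
case/shortenP => q qP uq _ ab lq.
apply: (tree_acyclic T (c := a :: q)) => /=.
  (* The cycle has at least three vertices: an empty path gives [a = b], and a single step would use
     the deleted edge. *)
  case: q qP lq {uq} => [|c [|d q]] //=.
    by move=> _ ba; rewrite ba eqxx in ab.
  by rewrite andbT => + bc; rewrite -bc /adj !inE eqxx.
rewrite /ucycle /= -/(uniq (a :: q)) uq andbT rcons_path -lq.
rewrite /= {2}/adj finset.setUC abE andbT.
by apply: sub_path qP => x y; rewrite /adj inE => /andP[].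
Qed.

Lemma edge_components a b x : [set a; b]%SET \in E ->
  connect (adj (E :\ [set a; b]%SET)%SET) a x ||
  connect (adj (E :\ [set a; b]%SET)%SET) b x.
Proof.
move=> abE; set F := (E :\ _)%SET.
have cl : closed (adj E) [pred y | connect (adj F) a y || connect (adj F) b y].
  apply: (intro_closed (connect_adj_sym E)) => y z yz; rewrite !inE.
  have [e|ne] := eqVneq [set y; z]%SET [set a; b]%SET.
    have : z \in [set a; b]%SET by rewrite -e !inE eqxx orbT.
    by rewrite !inE => /orP[]/eqP-> _; rewrite connect0 ?orbT.
  have yzF : connect (adj F) y z by apply: connect1; rewrite /adj !inE ne.
  by case/orP => h; rewrite (connect_trans h yzF) ?orbT.
have := closed_connect cl (tree_connected T a x); rewrite !inE connect0 /=.
by move=> <-.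
Qed.

(** Without [e] at most two components remain, so vertices cut off from [r] share the other one. *)
Lemma not_connect_trans e r x y : e \in E ->
  ~~ connect (adj (E :\ e)%SET) r x -> ~~ connect (adj (E :\ e)%SET) r y ->
  connect (adj (E :\ e)%SET) x y.
Proof.
move=> eE; have [a [b [_ eab]]] := edge_ends eE; rewrite eab in eE *.
set c := connect _; have cC := connect_adj_sym (E :\ [set a; b])%SET.
have tr := @connect_trans _ (adj (E :\ [set a; b])%SET).
move: (edge_components r eE) (edge_components x eE) (edge_components y eE).
rewrite -/c; case/orP => hr; case/orP => hx; case/orP => hy;
  move=> /negP nx /negP ny;
  by [case: nx; apply: tr hx; rewrite cC
     |case: ny; apply: tr hy; rewrite cC
     |apply: tr hy; rewrite cC].
Qed.

Lemma mem_walk_edges (x : V) p e : e \in walk_edges x p ->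
  exists p1 y p2, p = p1 ++ y :: p2 /\ e = [set last x p1; y]%SET.
Proof.
elim: p x => //= z p IH x; rewrite in_cons => /orP[/eqP->|/IH].
  by exists [::], z, p.
by case=> p1 [y [p2 [-> ->]]]; exists (z :: p1), y, p2.
Qed.

Lemma path_avoid e x p : path (adj E) x p -> e \notin walk_edges x p ->
  path (adj (E :\ e)%SET) x p.
Proof.
elim: p x => //= y p IH x /andP[xy py]; rewrite in_cons negb_or => /andP[ne np].
by rewrite IH // andbT /adj !inE eq_sym ne.
Qed.

Lemma walk_edges_sub (x : V) p e : e \in walk_edges x p ->
  {subset e <= x :: p}.
Proof.
case/mem_walk_edges => p1 [y [p2 [-> ->]]] z; rewrite !inE.
case/orP=> /eqP->; last by rewrite mem_cat !inE eqxx !orbT.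
have := mem_last x p1; rewrite inE mem_cat => /orP[->//|->].
by rewrite orbT.
Qed.

(** A path missing [e] survives its removal. Conversely, as no vertex repeats, the pieces before and
    after [e] avoid [e]; connecting [x] to [y] would then connect the two ends of [e], against
    [bridge]. *)
Lemma simple_path_edge e x y p : e \in E -> simple_path E x y p ->
  (e \in walk_edges x p) = ~~ connect (adj (E :\ e)%SET) x y.
Proof.
move=> eE /and3P[pP up /eqP lp]; apply/idP/idP; last first.
  apply: contraNT => /(path_avoid pP) pe.
  by apply/connectP; exists p.
case/mem_walk_edges => p1 [b [p2 [pE eE']]].
set a := last x p1 in eE'.
move: pP up lp; rewrite pE cat_path -cat_cons cat_uniq last_cat -/a [uniq (b :: _)]/= [path _ _ (_ :: _)]/=.
move=> /and3P[P1 ab P2] /and3P[U1 U12 /andP[bp2 U2]] lp.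
have {}U12 z : z \in b :: p2 -> z \notin x :: p1.
  by move=> zp; apply: contraNN U12 => zx; apply/hasP; exists z.
have ap1 : a \in x :: p1 by exact: mem_last.
have bp1 : b \notin x :: p1 by apply: (U12 b); exact: mem_head.
have c1 : connect (adj (E :\ e)%SET) x a.
  apply/connectP; exists p1 => //; apply: path_avoid P1 _.
  apply: contra bp1 => /walk_edges_sub; apply.
  by rewrite eE' !inE eqxx orbT.
have c2 : connect (adj (E :\ e)%SET) b y.
  apply/connectP; exists p2 => //; apply: path_avoid P2 _.
  apply/negP => /walk_edges_sub /(_ a); rewrite eE' !inE eqxx /=.
  by move=> /(_ isT) abp; move: (U12 a abp); rewrite ap1.
have nab : a != b by apply: contraNneq bp1 => <-.
rewrite eE' in eE; have := bridge eE nab; rewrite -eE'; apply: contra => c3.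
apply: (connect_trans (y := x)); first by rewrite connect_adj_sym.
by apply: (connect_trans c3); rewrite connect_adj_sym.
Qed.

Lemma tree_path_edge e x y : e \in E ->
  (e \in walk_edges x (tree_path T x y)) = ~~ connect (adj (E :\ e)%SET) x y.
Proof. by move=> eE; apply: simple_path_edge => //; exact: (xchooseP (simple_path_ex T x y)). Qed.

(** The vertices below [e] when the tree is rooted at [r], expressed by connectivity so that no
    parent map has to be built. *)
Definition side (r : V) (e : {set V}) : {set V} :=
  [set x | ~~ connect (adj (E :\ e)%SET) r x]%SET.

Lemma connect_side r e x y : e \in E ->
  connect (adj (E :\ e)%SET) x y = ((x \in side r e) == (y \in side r e)).
Proof.
move=> eE; rewrite !inE eqb_negLR negbK.
have cC := connect_adj_sym (E :\ e)%SET.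
have [rx|nrx] := boolP (connect _ r x); have [ry|nry] := boolP (connect _ r y) => /=.
- by apply: connect_trans ry; rewrite cC.
- by apply: contraNF nry; exact: connect_trans.
- by apply: contraNF nrx => h; apply: (connect_trans ry); rewrite cC.
- exact: not_connect_trans nrx nry.
Qed.

(** A walk without [e] that starts in [A] never leaves it, so all its edges are contained in [A],
    and [e'] is not one of them. *)
Lemma connect_region (A e e' : {set V}) x y :
  closed (adj (E :\ e)%SET) (mem A) ->
  x \in A -> connect (adj (E :\ e)%SET) x y ->
  ~~ (e' \subset A) -> connect (adj (E :\ e')%SET) x y.
Proof.
move=> clA xA /connectP[p pP ->] e'A.
elim: p x xA pP => //= z p IH x xA /andP[xz zp].
have zA : z \in A by have := clA _ _ xz; rewrite /= xA.
apply: connect_trans (IH _ zA zp); apply: connect1.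
move: xz; rewrite /adj !inE => /andP[_ ->]; rewrite andbT.
apply: contra e'A => /eqP <-; apply/fintype.subsetP => u.
by rewrite !inE => /orP[]/eqP->.
Qed.

Lemma side_closed r e : e \in E -> closed (adj (E :\ e)%SET) (mem (side r e)).
Proof.
move=> eE x y /connect1; rewrite (connect_side r) // => /eqP.
by [].
Qed.

Lemma side_laminar r e e' : e \in E -> e' \in E ->
  [|| side r e \subset side r e', side r e' \subset side r e
    | [disjoint side r e & side r e']].
Proof.
move=> eE e'E; have [<-|ee'] := eqVneq e e'; first by rewrite subxx.
have cl := side_closed r eE.
have [e's|e's] := boolP (e' \subset side r e); last first.
  (* [side r e] stays connected when [e'] is removed *)
  case: (finset.set_0Vmem (side r e)) => [->|[x xs]]; first by rewrite finset.sub0set.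
  have sE y : y \in side r e -> (x \in side r e') = (y \in side r e').
    move=> ys; apply/eqP; rewrite -connect_side //.
    by apply: (connect_region cl) => //; rewrite (connect_side r) // xs ys.
  have [xs'|xs'] := boolP (x \in side r e').
    by apply/or3P/Or31/fintype.subsetP => y /sE <-.
  by apply/or3P/Or33/pred0P => y /=; apply/negP => /andP[/sE <-]; exact/negP.
have rs f : r \notin side r f by rewrite inE connect0.
(* Here [e'] lies inside [side r e], so the complement, which contains [r], stays connected without
   [e'] and misses [side r e']. *)
suff -> : side r e' \subset side r e by rewrite orbT.
apply/fintype.subsetP => y; apply: contraTT => ys.
have := rs e'; suff -> : (r \in side r e') = (y \in side r e') by [].
apply/eqP; rewrite -connect_side //.
apply: (@connect_region (~: side r e)%SET e).
- by move=> u v /cl uv; rewrite !inE in uv *; rewrite uv.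
- by rewrite inE rs.
- by rewrite (connect_side r) // (negbTE ys) (negbTE (rs e)).
- have [a [b [_ e'ab]]] := edge_ends e'E.
  apply/negP => /fintype.subsetP /(_ a); rewrite e'ab !inE eqxx => /(_ isT).
  rewrite negbK => ra; move: e's => /fintype.subsetP /(_ a).
  by rewrite e'ab !inE eqxx ra => /(_ isT).
Qed.

End Bridges.

(** * Convex hulls and means *)

Section ConvexHull.
Variables (R : realType) (M : lmodType R).
Implicit Types A B : set M.

Lemma sub_conv_hull A : (A `<=` conv_hull A)%classic.
Proof. by move=> x Ax B [_]; apply. Qed.

Lemma conv_hull_sub A B : convex_set (B : set (convex_lmodType M)) ->
  (A `<=` B)%classic -> (conv_hull A `<=` B)%classic.
Proof. by move=> cB AB x; apply. Qed.

Lemma conv_hull_convex A : convex_set (conv_hull A : set (convex_lmodType M)).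
Proof.
move=> x y l /set_mem Ax /set_mem Ay; apply/mem_set => B [cB AB].
by apply/set_mem/cB; apply/mem_set; [apply: Ax | apply: Ay].
Qed.

Lemma convex_set_comb A (a : R) x y : convex_set (A : set (convex_lmodType M)) ->
  0 <= a <= 1 -> A x -> A y -> A (a *: x + (1 - a) *: y).
Proof.
move=> cA /andP[a0 a1] Ax Ay; apply: set_mem.
pose l : {i01 R} := Itv01 a0 a1.
by have := cA x y l (mem_set Ax) (mem_set Ay).
Qed.

(** Adding [z] to a mean of [n] points is a convex combination with weight [1 / (n + 1)] on [z].
    Splitting off [x] keeps the list nonempty. *)
Lemma convex_set_mean A x (s : seq M) : convex_set (A : set (convex_lmodType M)) ->
  (forall y, y \in x :: s -> A y) ->
  A ((size s).+1%:R^-1 *: (x + \sum_(y <- s) y)).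
Proof.
move=> cA; elim: s => [|z s IHs] As.
  by rewrite big_nil addr0 invr1 scale1r; apply: As; exact: mem_head.
have n0 n : n.+1%:R != 0 :> R by rewrite pnatr_eq0.
have Az : A z by apply: As; rewrite !inE eqxx orbT.
have {}IHs : A ((size s).+1%:R^-1 *: (x + \sum_(y <- s) y)).
  apply: IHs => y ys; apply: As.
  by move: ys; rewrite !in_cons => /orP[]->; rewrite ?orbT.
have -> : (size (z :: s)).+1%:R^-1 *: (x + \sum_(y <- z :: s) y) =
    (size s).+2%:R^-1 *: z +
    (1 - (size s).+2%:R^-1) *: ((size s).+1%:R^-1 *: (x + \sum_(y <- s) y)).
  rewrite big_cons addrCA scalerDr; congr (_ + _); rewrite scalerA; congr (_ *: _).
  rewrite -[X in X - _](divff (n0 (size s).+1)) -[X in _ / _ - X]mul1r -mulrBl.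
  by rewrite -[X in X - 1]natr1 addrK mulrAC divff ?mul1r.
apply: convex_set_comb => //.
by rewrite invr_ge0 ler0n invf_le1 ?ltr0n // ler1n.
Qed.

End ConvexHull.

(** * Linear bounds on convex hulls *)

Section LinearForms.
Variables (R : realType) (T : finType).

(** A half-space is convex, so bounds on integral points carry over to their hull. *)
Lemma conv_hull_le (A : set {ffun T -> R^o}) (w : T -> R) (c : R) :
  (forall x, A x -> \sum_r w r * x r <= c) ->
  forall x, conv_hull A x -> \sum_r w r * x r <= c.
Proof.
move=> Ac; apply: conv_hull_sub => // x y l /set_mem xc /set_mem yc; apply/mem_set.
rewrite /mkset in xc yc *.
have -> : \sum_r w r * (conv l x y : {ffun T -> R^o}) r =
    l%:num * (\sum_r w r * (x : {ffun T -> R^o}) r) +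
    (1 - l%:num) * (\sum_r w r * (y : {ffun T -> R^o}) r).
  rewrite !mulr_sumr -big_split; apply: eq_bigr => r _ /=.
  by rewrite !ffunE /= mulrDr !mulrA ![w r * _]mulrC.
have l0 : 0 <= l%:num by [].
have l1 : 0 <= 1 - l%:num by rewrite subr_ge0.
apply: (le_trans (lerD (ler_wpM2l l0 xc) (ler_wpM2l l1 yc))).
by rewrite -mulrDl addrCA subrr addr0 mul1r.
Qed.

End LinearForms.

(** * Upper bound on the gap *)

Section UpperBound.
Variables (R : realType) (I : anf_tree R).
Implicit Types (e : {set vtx I}) (r : req I) (Q : {set req I}) (S : {set {set vtx I}}).

Notation OPT := (max_profit (@P_hull R I)).

Lemma mem_req_path e r : e \in edges I ->
  (e \in req_path r) = ~~ connect (adj (edges I :\ e)%SET) (src r) (dst r).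
Proof. exact: tree_path_edge. Qed.

Lemma total_profit_bound (x : reqvec I) : (@P_lp R I `&` @binary R I)%classic x ->
  total_profit x <= \sum_(r : req I) profit r.
Proof.
case=> -[x01 _] _; apply: ler_sum => r _.
by have /andP[_ x1] := x01 r; rewrite ler_piMr // profit_ge0.
Qed.

Lemma le_max_profit (x : reqvec I) : (@P_lp R I `&` @binary R I)%classic x ->
  total_profit x <= OPT.
Proof.
move=> Px; apply: ub_le_sup; last by exists x => //; exact: sub_conv_hull.
exists (\sum_(r : req I) profit r) => _ [y Py <-].
exact: (conv_hull_le (A := (@P_lp R I `&` @binary R I)%classic) total_profit_bound).
Qed.

Lemma zero_feasible S : S \subset edges I -> (@K_lp R I S `&` @binary R I)%classic (0 : reqvec I).
Proof.
move=> SE; split=> [|r]; last by left; rewrite ffunE.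
split=> [r|e eS]; first by rewrite ffunE lexx ler01.
rewrite big1 => [|r _]; last by rewrite ffunE mulr0.
exact/ltW/cap_gt0/(fintype.subsetP SE).
Qed.

Lemma zero_level t : @P_level R I t 0.
Proof. by move=> S [SE _]; exact: sub_conv_hull (zero_feasible SE). Qed.

Lemma max_profit_ge0 : 0 <= OPT.
Proof.
have := le_max_profit (zero_feasible (subxx _)).
by rewrite /total_profit big1 // => r _; rewrite ffunE mulr0.
Qed.

Lemma K_lp_sub S S' : S \subset S' -> (@K_lp R I S' `<=` K_lp S)%classic.
Proof. by move=> SS' x [x01 xS]; split=> // e /(fintype.subsetP SS') /xS. Qed.

Lemma load_supported Q (y : reqvec I) e : (forall r, r \notin Q -> y r = 0) ->
  \sum_(r in req_on e) dem r * y r = \sum_(r in (req_on e :&: Q)%SET) dem r * y r.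
Proof.
move=> yQ; rewrite (big_setID Q) /= [X in _ + X]big1 ?addr0 // => r.
by rewrite inE => /andP[/yQ -> _]; rewrite mulr0.
Qed.

(* Up to taking the smallest capacity, a constraint restricted to [Q] only
   depends on which endpoints of [Q] lie below the edge in the rooted tree. *)
Lemma representative_edges Q : exists S, [/\ S \subset edges I, (#|S| <= 4 * #|Q|)%N &
  forall e, e \in edges I -> (req_on e :&: Q)%SET = finset.set0 \/
    exists2 e', e' \in S & (req_on e' :&: Q)%SET = (req_on e :&: Q)%SET /\ cap e' <= cap e].
Proof.
have /card_gt0P[v0 _] := tree_nonempty (treeP I).
pose Z := ((@src R I) @: Q :|: (@dst R I) @: Q)%SET.
pose trace e := (side (edges I) v0 e :&: Z)%SET.
pose F := (trace @: edges I :\ finset.set0)%SET.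
(* Hence [req_on e :&: Q] is determined by the trace of [e] alone. *)
have onE e r : e \in edges I -> r \in Q ->
    (r \in req_on e) = (src r \in trace e) (+) (dst r \in trace e).
  move=> eE rQ; rewrite inE mem_req_path // (connect_side (treeP I) v0) // !inE.
  by rewrite !imset_f // orbT !andbT -negb_eqb.
have cZ : (#|Z| <= 2 * #|Q|)%N.
  rewrite mul2n -addnn; apply: leq_trans (leq_card_setU _ _) _.
  by apply: leq_add; exact: leq_imset_card.
have cF : (#|F| <= 2 * #|Z|)%N.
  apply: laminar_card => [A B||A].
  - case/finset.setD1P => _ /imsetP[e eE ->] /finset.setD1P[_ /imsetP[e' e'E ->]].
    case/or3P: (side_laminar (treeP I) v0 eE e'E) => h.
    + by rewrite /trace finset.setSI.
    + by apply/or3P/Or32/finset.setSI.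
    + by rewrite (disjointWl _ (disjointWr _ h)) ?orbT // finset.subsetIl.
  - by rewrite !inE eqxx.
  - by case/finset.setD1P => _ /imsetP[e eE ->]; exact: finset.subsetIr.
(* [g] picks an edge of least capacity for each nonempty trace; its constraint, restricted to [Q],
   implies those of all edges with that trace. Outside [F] its value is a dummy. *)
have /choice[g gP] : forall A, exists e, A \in F -> [/\ e \in edges I, trace e = A &
    forall e', e' \in edges I -> trace e' = A -> cap e <= cap e'].
  move=> A; have [AF|AF] := boolP (A \in F); last by exists finset.set0.
  move: AF => /finset.setD1P[_ /imsetP[e0 e0E AE]].
  have P0 : (e0 \in edges I) && (trace e0 == A) by rewrite e0E AE eqxx.
  case: (@Order.TotalTheory.arg_minP _ _ _ e0 (fun e => (e \in edges I) && (trace e == A)) (@cap R I) P0) => e /andP[eE /eqP eA] emin.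
  by exists e => _; split=> // e' e'E e'A; apply: emin; rewrite e'E e'A eqxx.
exists (g @: F)%SET; split.
- by apply/fintype.subsetP => _ /imsetP[A /gP[gE _ _] ->].
- apply: leq_trans (leq_imset_card _ _) _; apply: leq_trans cF _.
  by rewrite -[4%N]/(2 * 2)%N -mulnA leq_mul2l.
- move=> e eE; have [e0|ne0] := eqVneq (trace e) finset.set0.
    left; apply/finset.setP => r; rewrite finset.in_setI finset.in_set0.
    by apply/negP => /andP[+ rQ]; rewrite onE // e0 !inE.
  have eF : trace e \in F by rewrite !inE ne0 imset_f.
  right; exists (g (trace e)); first exact: imset_f.
  have [gE gt gmin] := gP _ eF; split; last exact: gmin.
  apply/finset.setP => r; rewrite !finset.in_setI; have [rQ|rQ] := boolP (r \in Q).
    by rewrite !andbT !onE // gt.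
  by rewrite !andbF.
Qed.

(** For [t >= 4] the representatives number at most [4 * (t %/ 4) <= t]. For smaller [t], [Q] has at
    most one request: if some edge of its path is too small for its demand, that edge alone forces
    it to zero; otherwise it fits everywhere. *)
Lemma few_constraints Q t : (0 < t)%N -> (#|Q| <= maxn 1 (t %/ 4))%N ->
  exists S, [/\ S \subset edges I, (#|S| <= t)%N & forall y : reqvec I,
    (@K_lp R I S `&` @binary R I)%classic y -> (forall r, r \notin Q -> y r = 0) -> @P_lp R I y].
Proof.
move=> t0; have [t3|t4] := leqP t 3.
  rewrite divn_small // maxn0 => Q1.
  have [/existsP[r /existsP[e /and4P[rQ eE re cr]]]|fit] := boolP [exists r,
      exists e, [&& r \in Q, e \in edges I, r \in req_on e & cap e < dem r]].
    exists [set e]%SET; split; rewrite ?finset.sub1set ?cards1 // => y [[y01 yS] yb] yQ.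
    have QE : Q = [set r]%SET.
      by apply/eqP; rewrite eq_sym finset.eqEcard finset.sub1set rQ cards1.
    have y0 r' : y r' = 0.
      have [->|r'r] := eqVneq r' r; last by apply: yQ; rewrite QE inE.
      have := yS e (finset.set11 _); rewrite (load_supported _ yQ) QE.
      have -> : (req_on e :&: [set r] = [set r])%SET.
        by apply/finset.setIidPr; rewrite finset.sub1set.
      by rewrite big_set1; case: (yb r) => // ->; rewrite mulr1 leNgt cr.
    have -> : y = 0 by apply/ffunP => r'; rewrite y0 ffunE.
    by have [] := zero_feasible (subxx (edges I)).
  exists finset.set0; split; rewrite ?finset.sub0set ?cards0 // => y [[y01 _] _] yQ.
  split=> // e eE; rewrite (load_supported _ yQ).
  have [e0|[r]] := finset.set_0Vmem (req_on e :&: Q)%SET.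
    by rewrite e0 big_set0; exact/ltW/cap_gt0.
  move=> rQ; have -> : (req_on e :&: Q = [set r])%SET.
    apply/eqP; rewrite eq_sym finset.eqEcard finset.sub1set rQ cards1.
    by apply: leq_trans Q1; apply/subset_leq_card/finset.subsetIr.
  rewrite big_set1; move: rQ; rewrite finset.in_setI => /andP[re rQ].
  have /andP[y0 y1] := y01 r; apply: (@le_trans _ _ (dem r)).
    by rewrite ler_piMr // dem_ge0.
  by rewrite leNgt; apply: contraNN fit => h; apply/existsP; exists r;
    apply/existsP; exists e; apply/and4P.
have -> : maxn 1 (t %/ 4) = (t %/ 4)%N by apply/maxn_idPr; rewrite divn_gt0.
move=> Qt; have [S [SE cS Srep]] := representative_edges Q.
exists S; split=> // [|y [[y01 yS] _] yQ].
  by apply: leq_trans cS _; rewrite mulnC (leq_trans _ (leq_divM t 4)) // leq_mul2r.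
split=> // e eE; rewrite (load_supported _ yQ).
case: (Srep e eE) => [->|[e' e'S [<- cee']]]; first by rewrite big_set0; exact/ltW/cap_gt0.
by rewrite -(load_supported _ yQ); apply: le_trans (yS _ e'S) cee'.
Qed.

(** [P_level] ranges over sets of exactly [t] edges, so smaller sets of constraints have to be
    padded. *)
Lemma extend_subset (T : finType) (A B : {set T}) n : A \subset B ->
  (#|A| <= n <= #|B|)%N -> exists C : {set T}, [/\ A \subset C, C \subset B & #|C| = n].
Proof.
move=> AB /andP[An nB]; pose s := take (n - #|A|) (enum (B :\: A)%SET).
have sBA x : x \in s -> x \in (B :\: A)%SET by move/mem_take; rewrite mem_enum.
exists (A :|: [set x in s])%SET; split; first exact: finset.subsetUl.
  rewrite finset.subUset AB; apply/fintype.subsetP => x.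
  by rewrite inE => /sBA /finset.setDP[].
have -> : #|(A :|: [set x in s])%SET| = (#|A| + #|[set x in s]%SET|)%N.
  apply/eqP; rewrite (leq_card_setU A [set x in s]%SET).2 disjoint_sym.
  rewrite disjoint_subset; apply/fintype.subsetP => x; rewrite inE => /sBA.
  by rewrite !inE => /andP[].
rewrite cardsE (card_uniqP _) ?take_uniq ?enum_uniq // size_takel ?subnKC //.
rewrite -cardE cardsD (finset.setIidPr AB); exact: leq_sub2r.
Qed.

Lemma group_profit_le Q t (x : reqvec I) : (0 < t <= nedge I)%N ->
  (#|Q| <= maxn 1 (t %/ 4))%N -> @P_level R I t x ->
  \sum_(r in Q) profit r * x r <= OPT.
Proof.
move=> /andP[t0 tm] Qt xt; have [S [SE cS SP]] := few_constraints t0 Qt.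
have [|S' [SS' S'E cS']] := extend_subset (n := t) SE; first by rewrite cS tm.
pose w r := if r \in Q then profit r else 0.
have wE (y : reqvec I) : \sum_(r in Q) profit r * y r = \sum_r w r * y r.
  by rewrite big_mkcond; apply: eq_bigr => r _; rewrite /w; case: ifP; rewrite ?mul0r.
rewrite wE; apply: conv_hull_le (xt S' (conj S'E cS')) => y [yS yb].
(* Dropping the requests outside [Q] only lowers loads, since demands are nonnegative; the
   constraints in [S] then make [z] feasible for every edge. *)
pose z : reqvec I := [ffun r => if r \in Q then y r else 0].
have zb : @binary R I z by move=> r; rewrite ffunE; case: ifP => _; [exact: yb|left].
have zQ r : r \notin Q -> z r = 0 by rewrite ffunE => /negbTE ->.
have zS : K_lp S z.
  have [y01 yl] := K_lp_sub SS' yS; split=> [r|e /yl].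
    by rewrite ffunE; case: ifP => _ //; rewrite lexx ler01.
  apply: le_trans; apply: ler_sum => r _; rewrite ffunE; case: ifP => _ //.
  by rewrite mulr0 mulr_ge0 ?dem_ge0 //; have /andP[] := y01 r.
have := le_max_profit (conj (SP _ (conj zS zb) zQ) zb); congr (_ <= _).
apply: eq_bigr => r _; rewrite ffunE /w; case: ifP => //.
by rewrite mulr0 mul0r.
Qed.

Lemma level_profit_le t (x : reqvec I) : (0 < t <= nedge I)%N -> @P_level R I t x ->
  total_profit x <= (9 * Num.max 1 ((nreq I)%:R / t%:R)) * OPT.
Proof.
move=> tm xt; set q := maxn 1 (t %/ 4); set k := nreq I.
have q0 : (0 < q)%N by rewrite leq_max.
(* Requests are grouped by rank divided by [q]; the extra group takes the remainder. *)
have grp r : (enum_rank r %/ q < (k %/ q).+1)%N.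
  by rewrite ltnS leq_div2r // ltnW // ltn_ord.
have -> : total_profit x = \sum_(j < (k %/ q).+1)
    \sum_(r | Ordinal (grp r) == j) profit r * x r.
  by rewrite /total_profit (partition_big (fun r => Ordinal (grp r)) predT).
apply: (@le_trans _ _ (\sum_(j < (k %/ q).+1) OPT)).
  apply: ler_sum => j _.
  pose Q := [set r | Ordinal (grp r) == j]%SET.
  rewrite (eq_bigl (mem Q)) => [|r]; last by rewrite !inE.
  apply: (group_profit_le tm) => //; rewrite -/q.
  (* Ranks in one group differ modulo [q], so a group has at most [q] requests. *)
  pose h r := Ordinal (ltn_pmod (enum_rank r) q0).
  have hinj : {in Q &, injective h}.
    move=> r r'; rewrite !inE => /eqP/(congr1 val) /= rj /eqP/(congr1 val) /= r'j.
    move=> /(congr1 val) /= hh; apply/enum_rank_inj/val_inj => /=.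
    by rewrite (divn_eq (enum_rank r) q) (divn_eq (enum_rank r') q) rj r'j hh.
  by rewrite -(card_in_imset hinj) -[X in (_ <= X)%N]card_ord max_card.
rewrite sumr_const card_ord -[_ *+ _]mulr_natl.
apply: ler_wpM2r; first exact: max_profit_ge0.
have t0 : (0 < t)%N by case/andP: tm.
(* [t < 4 * (t %/ 4 + 1) <= 4 * (q + 1) <= 8 * q]. The [k %/ q] groups thus give the factor 8, and
   the remaining group raises it to 9. *)
have qt : (t <= 8 * q)%N.
  have q1 : (t %/ 4 <= q)%N by exact: leq_maxr.
  by have := ltn_ceil t (isT : (0 < 4)%N); lia.
have h1 : (1 : R) <= Num.max 1 (k%:R / t%:R) by rewrite le_max lexx.
have h2 : (k %/ q)%:R <= 8 * Num.max 1 (k%:R / t%:R) :> R.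
  apply: (@le_trans _ _ (8 * (k%:R / t%:R))).
    rewrite mulrA ler_pdivlMr ?ltr0n // -natrM -natrM ler_nat.
    apply: leq_trans (_ : (k %/ q) * (8 * q) <= _)%N; first by rewrite leq_mul2l qt orbT.
    by rewrite mulnCA leq_mul2l leq_divM.
  by rewrite ler_wpM2l // le_max lexx orbT.
by rewrite -natr1; lra.
Qed.

Lemma integrality_gap_le t : (0 < t <= nedge I)%N ->
  (integrality_gap I t <= (9 * Num.max 1 ((nreq I)%:R / t%:R))%:E)%E.
Proof.
move=> tm; set c := 9 * _.
have ub : max_profit (@P_level R I t) <= c * OPT.
  apply: ge_sup; last by move=> _ [x xt <-]; exact: level_profit_le.
  by exists (total_profit (0 : reqvec I)); exists 0; first exact: zero_level.
have c0 : 0 <= c by rewrite mulr_ge0 // le_max ler01.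
have lb : 0 <= max_profit (@P_level R I t).
  have -> : 0 = total_profit (0 : reqvec I).
    by rewrite /total_profit big1 // => r _; rewrite ffunE mulr0.
  apply: ub_le_sup; first by exists (c * OPT) => _ [x xt <-]; exact: level_profit_le.
  by exists 0; first exact: zero_level.
(* If the optimum is 0, so is the maximum over the level, and the quotient is 0 because 0 times any
   extended real is 0. *)
rewrite /integrality_gap; have := max_profit_ge0; rewrite le_eqVlt => /predU1P[O0|O0].
  have -> : max_profit (@P_level R I t) = 0.
    by apply/le_anti; rewrite lb (le_trans ub) // -O0 mulr0.
  by rewrite mul0e lee_fin.
by rewrite inver gt_eqF // -EFinM lee_fin ler_pdivrMr.
Qed.

End UpperBound.

(** * The path graph as a tree *)

Section PathGraph.
Variable N : nat.
Implicit Types (x y : 'I_N.+1) (j : nat).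

Definition path_edge j : {set 'I_N.+1} := [set inord j; inord j.+1]%SET.

Definition path_edges : {set {set 'I_N.+1}} := [set path_edge j | j : 'I_N]%SET.

Lemma path_edge_in j : (j < N)%N -> path_edge j \in path_edges.
Proof. by move=> jN; apply/imsetP; exists (Ordinal jN). Qed.

Lemma pair_path_edge x y j : (j < N)%N -> [set x; y]%SET = path_edge j ->
  (x = j :> nat /\ y = j.+1 :> nat) \/ (x = j.+1 :> nat /\ y = j :> nat).
Proof.
move=> jN /finset.setP exy.
have vE i : (i <= N)%N -> (inord i : 'I_N.+1) = i :> nat by exact: (@inordK N).
have E z : ((z == x) || (z == y)) = ((z == j :> nat) || (z == j.+1 :> nat)).
  by have := exy z; rewrite !inE -!val_eqE /= !vE // ltnW.
have := E x; have := E y; have := E (inord j); have := E (inord j.+1).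
by rewrite !eqxx ?orbT -!val_eqE /= !vE ?(ltnW jN) //; lia.
Qed.

Lemma adj_path_edges x y : adj path_edges x y ->
  (y = x.+1 :> nat) \/ (x = y.+1 :> nat).
Proof.
case/imsetP => j _ /(pair_path_edge (ltn_ord j)).
by case=> -[-> ->]; [left|right].
Qed.

(** [F] is arbitrary so as to serve both the whole path and the path minus an edge. *)
Lemma connect_path_edges (F : {set {set 'I_N.+1}}) x :
  (forall j, (j < x)%N -> path_edge j \in F) -> connect (adj F) ord0 x.
Proof.
move=> xF; rewrite -[x]inord_val; have := ltn_ord x; rewrite ltnS.
elim: {-2}(val x) (leqnn x) => [_ _|j IHj jx jN].
  by rewrite (_ : inord 0 = ord0) //; apply: val_inj; rewrite /= inordK.
apply: connect_trans (IHj (ltnW jx) (ltnW jN)) _; apply: connect1; exact: xF.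
Qed.

Lemma path_edges_tree : is_tree path_edges.
Proof.
split.
- by rewrite card_ord.
- move=> _ /imsetP[j _ ->]; rewrite cards2 (_ : _ != _) //.
  by rewrite -val_eqE /= !inordK ?ltnS ?ltn_ord // 1?ltnW // neq_ltn ltnSn.
- move=> x y; apply: (@connect_trans _ _ ord0).
    rewrite connect_adj_sym; apply: connect_path_edges => j jx.
    by apply: path_edge_in; apply: leq_trans jx _; rewrite -ltnS.
  apply: connect_path_edges => j jx.
  by apply: path_edge_in; apply: leq_trans jx _; rewrite -ltnS.
- (* both neighbours on the cycle of its largest vertex [x] must be [x - 1] *)
  move=> c c2 cc; have c0 : head ord0 c \in c by case: c c2 {cc} => //= a s _; exact: mem_head.
  case: (@arg_maxnP _ (head ord0 c) (mem c) val c0) => x xc xmax.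
  case/rot_to: xc => i s cE.
  have := cc; rewrite -(rot_ucycle i) cE => /andP[/= pth /andP[xs us]].
  have sz : (1 < size s)%N by rewrite -ltnS -[(size s).+1]/(size (x :: s)) -cE size_rot.
  have smax y : y \in s -> (y <= x)%N.
    by move=> ys; apply: xmax => /=; rewrite -(mem_rot i) cE in_cons ys orbT.
  case: s sz pth us smax {cE xs} => // y s; case/lastP: s => // s z _ /=.
  rewrite rcons_path last_rcons => /and3P[/adj_path_edges xy _ /adj_path_edges zx].
  rewrite mem_rcons inE negb_or => /andP[/andP[/negP yz _] _] smax; apply: yz.
  have := smax y (mem_head _ _).
  have : (z <= x)%N by apply: smax; rewrite !inE mem_rcons inE eqxx orbT.
  by rewrite -val_eqE /=; lia.
Qed.

Lemma connect_path_edgesD1 j x : (j < N)%N ->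
  connect (adj (path_edges :\ path_edge j)%SET) ord0 x = (x <= j)%N.
Proof.
move=> jN; apply/idP/idP => [|xj].
  set F := (_ :\ _)%SET => cx.
  (* The only edge leaving the vertices up to [j] is the removed one. *)
  have cl : closed (adj F) [pred y : 'I_N.+1 | (y <= j)%N].
    apply: (intro_closed (connect_adj_sym F)) => y z; rewrite !inE => yz yj.
    move: yz; rewrite /adj !inE => /andP[ne /adj_path_edges yz].
    have [//|jz] := leqP z j; case/negP: ne; apply/eqP.
    have -> : y = inord j by apply: val_inj; rewrite /= inordK ?(ltnW jN) //; lia.
    have -> : z = inord j.+1 by apply: val_inj; rewrite /= inordK //; lia.
    by [].
  by have := closed_connect cl cx; rewrite !inE => <-.
apply: connect_path_edges => i ix; have ij := leq_trans ix xj.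
rewrite finset.in_setD1 path_edge_in ?(ltn_trans ij) // andbT.
apply/eqP => /pair_path_edge; case=> //; rewrite !inordK ?ltnS; lia.
Qed.

Lemma card_path_edges : #|path_edges| = N.
Proof.
rewrite card_imset ?card_ord // => i j /(pair_path_edge (ltn_ord j)).
rewrite !inordK ?ltnS ?ltn_ord // 1?ltnW // => h.
by apply: val_inj => /=; lia.
Qed.

End PathGraph.

(** * Instances with a large gap *)

Section LowerBound.
Variables (R : realType) (k t : nat).

(** Requests end at vertices up to [k]; the [t] further edges ensure that level [t] exists even when
    [t > k]. *)
Notation N := (k + t)%N.

(* For [path_edge j] the exponent below is [(j + j.+1)./2 = j]. *)
Definition path_cap (e : {set 'I_N.+1}) : R := 2^-1 ^+ (\sum_(x in e) (x : nat))./2.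

Lemma path_cap_edge j : (j < N)%N -> path_cap (path_edge N j) = 2^-1 ^+ j.
Proof.
move=> jN; rewrite /path_cap; congr (_ ^+ _).
have jj : (inord j : 'I_N.+1) \notin [set (inord j.+1 : 'I_N.+1)]%SET.
  by rewrite inE -val_eqE /= !inordK ?ltnS // 1?ltnW // neq_ltn ltnSn.
rewrite finset.big_setU1 //= big_set1 !inordK ?ltnS // 1?ltnW //.
by rewrite addnS addnn /= uphalf_double.
Qed.

Lemma path_cap_gt0 e : e \in path_edges N -> 0 < path_cap e.
Proof. by move=> _; rewrite exprn_gt0 // invr_gt0 ltr0n. Qed.

Lemma path_src_neq_dst (r : 'I_k) : (ord0 : 'I_N.+1) != inord r.+1.
Proof.
by rewrite -val_eqE /= inordK // ltnS (leq_trans (ltn_ord r)) // leq_addr.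
Qed.

Lemma path_dem_ge0 (r : 'I_k) : 0 <= 2^-1 ^+ r :> R.
Proof. by rewrite exprn_ge0 // invr_ge0 ler0n. Qed.

Definition path_instance : anf_tree R := AnfTree (path_edges_tree N) path_cap_gt0
  path_src_neq_dst path_dem_ge0 (fun=> ler01).

Notation J := path_instance.

(** The last edge on the path of [r], whose capacity equals the demand of [r]. *)
Definition req_edge (r : req J) : {set vtx J} := path_edge N (r : 'I_k).

Lemma req_edge_in r : req_edge r \in edges J.
Proof. by apply: path_edge_in; apply: leq_trans (ltn_ord r) (leq_addr _ _). Qed.

Lemma path_req_on (r : req J) j : (j < N)%N ->
  (r \in req_on (path_edge N j : {set vtx J})) = (j <= (r : 'I_k))%N.
Proof.
move=> jN; rewrite inE mem_req_path; last exact: path_edge_in.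
rewrite /= connect_path_edgesD1 // inordK -?ltnNge //.
by rewrite ltnS (leq_trans (ltn_ord r)) // leq_addr.
Qed.

(** The subtracted term makes the induction close; [maxn] lets it cancel when the sum is empty. *)
Lemma geometric_tail j n :
  \sum_(r < n | (j < r)%N) 2^-1 ^+ r <= 2^-1 ^+ j - 2^-1 ^+ maxn j n.-1 :> R.
Proof.
elim: n => [|n IHn]; first by rewrite big_ord0 maxn0 subrr.
rewrite big_mkcond big_ord_recr /= -big_mkcond /=.
case: ifP => [jn|/negbT]; last first.
  rewrite -leqNgt addr0 => nj; rewrite (maxn_idPl nj).
  by rewrite (maxn_idPl (leq_trans (leq_pred n) nj)) in IHn.
have n0 : n = n.-1.+1 by rewrite prednK // (leq_ltn_trans _ jn).
have jn1 : (j <= n.-1)%N by rewrite -ltnS -n0.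
rewrite (maxn_idPr (ltnW jn)); rewrite (maxn_idPr jn1) in IHn.
have -> : 2^-1 ^+ n = 2^-1 * 2^-1 ^+ n.-1 :> R by rewrite {1}n0 exprS.
by move: IHn; lra.
Qed.

Lemma sum_path_req_on j (f : 'I_k -> R) : (j < N)%N ->
  \sum_(r in req_on (path_edge N j : {set vtx J})) f r =
  \sum_(r < k | (j <= r)%N) f r.
Proof. by move=> jN; apply: eq_bigl => r; rewrite path_req_on. Qed.

(** The demand [2^-r] is at most the capacity [2^-j] of each edge [j <= r] on its path. If [e] is
    the last edge of no request, the vector is zero, so [e] may range over all of [S]. *)
Lemma single_feasible (S : {set {set vtx J}}) e : S \subset edges J ->
  (@K_lp R J S `&` @binary R J)%classic [ffun r => (req_edge r == e)%:R].
Proof.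
move=> SE; split=> [|r]; last by rewrite ffunE; case: eqP; [right|left].
split=> [r|f fS]; first by rewrite ffunE; case: eqP; rewrite ?lexx ?ler01.
have /imsetP[[j jN] _ /= fE] := fintype.subsetP SE _ fS.
rewrite fE sum_path_req_on // path_cap_edge //.
have h0 i : 0 <= 2^-1 ^+ i :> R by rewrite exprn_ge0 // invr_ge0 ler0n.
have [/existsP[r /eqP re]|nr] := boolP [exists r, req_edge r == e]; last first.
  rewrite big1 => [|r _]; first exact: h0.
  have := nr; rewrite negb_exists => /forallP /(_ r) /negbTE rne.
  by rewrite ffunE rne mulr0.
have inj (r' : 'I_k) : r' != r -> (req_edge r' == e) = false.
  move=> r'r; apply/eqP; rewrite -re => /pair_path_edge.
  have rN := leq_trans (ltn_ord r) (leq_addr t k).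
  have r'N := leq_trans (ltn_ord r') (leq_addr t k).
  move=> /(_ rN); rewrite !inordK ?ltnS // 1?ltnW // => h.
  by case/eqP: r'r; apply: val_inj => /=; lia.
rewrite big_mkcond (bigD1 r) //= [X in _ + X]big1 => [|r' r'r]; last first.
  by rewrite ffunE inj // mulr0 if_same.
rewrite addr0 ffunE re eqxx mulr1; case: ifP => // jr.
by rewrite ler_wiXn2l // ?invr_ge0 ?ler0n // invf_le1 ?ltr0n // ler1n.
Qed.

(** On edge [j] of [S], a request ending there is dropped, and the demands of the later ones sum to
    at most [2^-j], the capacity. *)
Lemma rest_feasible (S : {set {set vtx J}}) : S \subset edges J ->
  (@K_lp R J S `&` @binary R J)%classic [ffun r => (req_edge r \notin S)%:R].
Proof.
move=> SE; split=> [|r]; last by rewrite ffunE; case: (_ \notin _); [right|left].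
split=> [r|f fS]; first by rewrite ffunE; case: (_ \notin _); rewrite ?lexx ?ler01.
have /imsetP[[j jN] _ /= fE] := fintype.subsetP SE _ fS.
have h0 i : 0 <= 2^-1 ^+ i :> R by rewrite exprn_ge0 // invr_ge0 ler0n.
rewrite fE sum_path_req_on // path_cap_edge //.
apply: (@le_trans _ _ (\sum_(r < k | (j < r)%N) 2^-1 ^+ r)); last first.
  by apply: le_trans (geometric_tail j k) _; rewrite gerBl.
rewrite [X in X <= _]big_mkcond [X in _ <= X]big_mkcond; apply: ler_sum => r _.
rewrite leq_eqVlt ffunE; have [jr|_] := eqVneq j r => /=.
  have -> : req_edge r = f by rewrite fE jr.
  by rewrite fS mulr0 jr ltnn.
by case: ifP => // _; rewrite ler_piMr //; case: (_ \notin _); rewrite ?ler01.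
Qed.

Lemma uniform_level : @P_level R J t [ffun=> t.+1%:R^-1].
Proof.
move=> S [SE cS].
pose s := [seq ([ffun r => (req_edge r == e)%:R] : reqvec J) | e <- enum S].
have := @convex_set_mean _ _ (K_hull S) [ffun r => (req_edge r \notin S)%:R] s
  (@conv_hull_convex _ _ _).
rewrite size_map -cardE cS => /(_ _).
set x := _ *: _; have -> : x = [ffun=> t.+1%:R^-1].
  apply/ffunP => r; rewrite !ffunE /= sum_ffunE big_map big_enum /=.
  rewrite -[RHS]mulr1; congr (_ * _).
  under eq_bigr do rewrite ffunE.
  (* Each request is selected by exactly one of the [t + 1] points: the single point of its last
     edge if that edge is in [S], the remainder point otherwise. *)
  have [rS|rS] := boolP (req_edge r \in S); rewrite /=.
    rewrite add0r (bigD1 (req_edge r)) //= eqxx big1 ?addr0 // => e /andP[_].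
    by rewrite eq_sym => /negbTE ->.
  rewrite big1 ?addr0 // => e eS; case: eqP => // re.
  by rewrite re eS in rS.
apply=> y; rewrite in_cons => /orP[/eqP->|/mapP[e eS ->]].
  exact: sub_conv_hull (rest_feasible SE).
exact: sub_conv_hull (single_feasible e SE).
Qed.

Lemma path_profit_le1 (y : reqvec J) : (@P_lp R J `&` @binary R J)%classic y ->
  total_profit y <= 1.
Proof.
move=> [[y01 yl] yb].
(* Request [r] already saturates its last edge, and [r'] crosses that edge with positive demand. *)
have conflict (r r' : 'I_k) : (r < r')%N -> y r = 1 -> y r' = 1 -> False.
  move=> rr' yr yr'; have rN := leq_trans (ltn_ord r) (leq_addr t k).
  have := yl (path_edge N r) (req_edge_in r); rewrite sum_path_req_on //= path_cap_edge //.
  rewrite (bigD1 r) //= yr mulr1 (bigD1 r') /=; last first.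
    by rewrite (ltnW rr') -val_eqE /= gtn_eqF.
  rewrite yr' mulr1; apply/negP; rewrite -ltNge ltrDl; apply: ltr_wpDr.
    apply: sumr_ge0 => i _; apply: mulr_ge0; first exact: path_dem_ge0.
    by have /andP[] := y01 i.
  by apply: exprn_gt0; rewrite invr_gt0 ltr0n.
rewrite /total_profit; have [/existsP[r /eqP yr]|ny] := boolP [exists r, y r == 1].
  rewrite (bigD1 r) //= yr mulr1 big1 ?addr0 // => r' r'r.
  case: (yb r') => yr'; first by rewrite yr' mulr0.
  case: (ltngtP (r : 'I_k) (r' : 'I_k)) => [/conflict|/conflict|/val_inj rr'].
  - by move=> /(_ yr yr').
  - by move=> /(_ yr' yr).
  - by rewrite rr' eqxx in r'r.
rewrite big1 ?ler01 // => r _; case: (yb r) => yr; first by rewrite yr mulr0.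
by move: ny; rewrite negb_exists => /forallP /(_ r); rewrite yr eqxx.
Qed.

Lemma path_gap_ge : (0 < k)%N -> (0 < t)%N ->
  ((2^-1 * (k%:R / t%:R))%:E <= integrality_gap J t)%E.
Proof.
move=> k0 t0.
have opt1 : max_profit (@P_hull R J) <= 1.
  apply: ge_sup => [|_ [y Py <-]]; last first.
    exact: (conv_hull_le (A := (@P_lp R J `&` @binary R J)%classic) path_profit_le1).
  exists (total_profit (0 : reqvec J)); exists 0 => //.
  exact: sub_conv_hull (zero_feasible (subxx _)).
have opt0 : 0 < max_profit (@P_hull R J).
  pose r0 : req J := Ordinal k0.
  apply: lt_le_trans (le_max_profit (single_feasible (req_edge r0) (subxx _))).
  rewrite /total_profit (bigD1 r0) //= ffunE eqxx mulr1 ltr_wpDr ?ltr01 //.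
  by apply: sumr_ge0 => r _; rewrite mul1r ffunE ler0n.
have tN : (0 < t <= nedge J)%N.
  by rewrite t0 /nedge card_path_edges leq_addl.
have lb : k%:R / t.+1%:R <= max_profit (@P_level R J t).
  apply: le_trans (_ : total_profit ([ffun=> t.+1%:R^-1] : reqvec J) <= _).
    rewrite /total_profit; under eq_bigr do rewrite ffunE mul1r.
    by rewrite sumr_const [X in _ <= _ *+ X]card_ord mulr_natl.
  apply: ub_le_sup; last by exists [ffun=> t.+1%:R^-1] => //; exact: uniform_level.
  (* The upper bound supplies the boundedness that the supremum requires. *)
  by eexists => _ [x xt <-]; exact: level_profit_le xt.
rewrite /integrality_gap inver gt_eqF // -EFinM lee_fin ler_pdivlMr //.
(* The optimum is at most 1, and [t + 1 <= 2 * t] yields the constant [1/2]. *)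
apply: le_trans lb; apply: (@le_trans _ _ (2^-1 * (k%:R / t%:R))).
  by rewrite ler_piMr // mulr_ge0 ?invr_ge0 ?divr_ge0 ?ler0n.
rewrite mulrCA ler_wpM2l ?ler0n // -invfM lef_pV2 ?posrE ?ltr0n //.
  by rewrite -natrM ler_nat; lia.
by rewrite mulr_gt0 ?ltr0n.
Qed.

End LowerBound.

(** The maximum with 1 is there because the gap is at least 1 whenever the optimum is positive,
    while [k / t] tends to 0 for large [t]. *)
Theorem theorem3 (R : realType) :
  (exists2 C : R, 0 < C &
     forall (I : anf_tree R) (t : nat), (1 <= t <= nedge I)%N ->
       (integrality_gap I t
          <= (C * Num.max 1 ((nreq I)%:R / t%:R))%:E)%E)
  /\
  (exists2 c : R, 0 < c &
     forall k t : nat, (1 <= k)%N -> (1 <= t)%N ->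
       exists I : anf_tree R,
         [/\ nreq I = k, (t <= nedge I)%N
           & ((c * (k%:R / t%:R))%:E <= integrality_gap I t)%E]).

Proof.
split; [exists 9 | exists 2^-1]; rewrite ?invr_gt0 ?ltr0n //.
  by move=> I t; exact: integrality_gap_le.
move=> k t k0 t0; exists (path_instance R k t); split; last exact: path_gap_ge.
  by rewrite /nreq card_ord.
by rewrite /nedge card_path_edges leq_addl.
Qed.
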